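(* Let $\mathbb{F}$ be a field of characteristic $\neq2,3$ and let $\mathcal{L}$ be a Lie algebra over $\mathbb{F}$ which contains a subalgebra isomorphic to $\mathfrak{sl}(\mathsf{V})$ for a vector space $\mathsf{V}$ of dimension $3$, so that $\mathcal{L}$ decomposes, as a module for $\mathfrak{sl}(\mathsf{V})$, into a direct sum of copies of the adjoint module, the natural module $\mathsf{V}$, its dual $\mathsf{V}^*$, and the trivial one-dimensional module; thus $$\mathcal{L}=\bigl(\mathfrak{sl}(\mathsf{V})\otimes \mathsf{A}\bigr)\oplus\bigl(\mathsf{V}\otimes \mathsf{B}\bigr)\oplus\bigl(\mathsf{V}^*\otimes \mathsf{C}\bigr)\oplus\mathfrak{s}$$ for vector spaces $\mathsf{A},\mathsf{B},\mathsf{C}$ and a subalgebra $\mathfrak{s}$, with associated products $aa'$, $ab$, $ca$, $T(b,c)$, $b_1\times b_2$, $c_1\times c_2$ determined by the bracket of $\mathcal{L}$ as described in the context. Then the vector space $$\mathcal{A}=\begin{pmatrix} \mathsf{A}&\mathsf{C}\\ \mathsf{B}& \mathsf{A}\end{pmatrix}$$ of $2\times2$ matrices with diagonal entries in $\mathsf{A}$, $(1,2)$-entry in $\mathsf{C}$ and $(2,1)$-entry in $\mathsf{B}$, with the multiplication $$\begin{pmatrix} a_1& c\\ b&a_2\end{pmatrix}\cdot\begin{pmatrix} a_1'& c'\\ b'&a_2'\end{pmatrix} =\begin{pmatrix} a_1a_1'-T(b',c)& c'a_1+ca_2'+b\times b'\\ a_1'b+a_2b'+c\times c'&a_2'a_2-T(b,c')\end{pmatrix}$$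 and the involution $$\overline{\begin{pmatrix} a_1& c\\ b&a_2\end{pmatrix}} =\begin{pmatrix} a_2& c\\ b&a_1\end{pmatrix},$$ is a structurable algebra.
   Context: Setup: in the decomposition of $\mathcal{L}$, $\mathfrak{s}$ is the subalgebra of elements of $\mathcal{L}$ annihilated by the given copy of $\mathfrak{sl}(\mathsf{V})$, and $\mathsf{A}$ contains a distinguished element $1$ such that $\mathfrak{sl}(\mathsf{V})\otimes1$ is the given copy of $\mathfrak{sl}(\mathsf{V})$ (with $x\leftrightarrow x\otimes 1$). Invariance of the bracket under $\mathfrak{sl}(\mathsf{V})\otimes 1$ forces the bracket to have the form $$\begin{aligned} [x\otimes a,y\otimes a']&=[x,y]\otimes \tfrac{1}{2}\,a\circ a' + (x\circ y)\otimes \tfrac{1}{2} [a,a']+(x\vert y)D_{a,a'},\\ [x\otimes a,u\otimes b]&=xu\otimes ab,\qquad [v^*\otimes c,x\otimes a]=v^*x\otimes ca,\\ [u\otimes b,v^*\otimes c]&=\bigl(uv^*-\tfrac{1}{3}(v^*u)\mathsf{I}_3\bigr)\otimes T(b,c)+\tfrac{1}{3}(v^*u)D_{b,c},\\ [u_1\otimes b_1,u_2\otimes b_2]&= (u_1\wedge u_2) \otimes (b_1\times b_2),\qquad [v_1^*\otimes c_1,v_2^*\otimes c_2]= (v_1^*\wedge v_2^* ) \otimes (c_1\times c_2),\\ [d,x\otimes a]&=x\otimes da,\quad [d,u\otimes b]=u\otimes db,\quad [d,v^*\otimes c]=v^*\otimes dc \end{aligned}$$ for $x,y\in\mathfrak{sl}(\mathsf{V})$,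 $u,u_1,u_2\in\mathsf{V}$, $v^*,v_1^*,v_2^*\in\mathsf{V}^*$, $d\in\mathfrak{s}$, $a,a'\in\mathsf{A}$, $b,b_1,b_2\in\mathsf{B}$, $c,c_1,c_2\in\mathsf{C}$, with bilinear maps $\circ:\mathsf{A}\times\mathsf{A}\to\mathsf{A}$ (commutative), $[\,,]:\mathsf{A}\times\mathsf{A}\to\mathsf{A}$ (anticommutative), $D:\mathsf{A}\times\mathsf{A}\to\mathfrak{s}$ (skew-symmetric), $\mathsf{A}\times\mathsf{B}\to\mathsf{B}$, $\mathsf{C}\times\mathsf{A}\to\mathsf{C}$, $T:\mathsf{B}\times\mathsf{C}\to\mathsf{A}$, $D:\mathsf{B}\times\mathsf{C}\to\mathfrak{s}$, $\times:\mathsf{B}\times\mathsf{B}\to\mathsf{C}$ (symmetric), $\times:\mathsf{C}\times\mathsf{C}\to\mathsf{B}$ (symmetric), and representations of $\mathfrak{s}$ on $\mathsf{A},\mathsf{B},\mathsf{C}$. The multiplication on $\mathsf{A}$ is $aa'=\frac12 a\circ a'+\frac12[a,a']$. Notation: $\mathfrak{sl}(\mathsf{V})$ is the Lie algebra of trace-zero endomorphisms of $\mathsf{V}$, $\mathsf{I}_3$ the identity map of $\mathsf{V}$; for $x,y\in\mathfrak{sl}(\mathsf{V})$: $[x,y]=xy-yx$, $x\circ y=xy+yx-\frac23\operatorname{tr}(xy)\mathsf{I}_3$, $(x\vert y)=\frac13\operatorname{tr}(xy)$; $xu=x(u)$, $v^*x=v^*\circ x$ (composition), $v^*u=v^*(u)$,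 and $uv^*$ is the endomorphism $w\mapsto v^*(w)u$. Fix a nonzero linear map $\det:\bigwedge^3\mathsf{V}\to\mathbb{F}$; it determines $\det:\bigwedge^3\mathsf{V}^*\to\mathbb{F}$ such that $\det(f_1\wedge f_2\wedge f_3)\det(v_1\wedge v_2\wedge v_3)$ equals the usual determinant of $(f_i(v_j))$. Identify $\bigwedge^2\mathsf{V}$ with $\mathsf{V}^*$ by $u_1\wedge u_2\leftrightarrow\det(u_1\wedge u_2\wedge\,\cdot\,)$ and likewise $\bigwedge^2\mathsf{V}^*$ with $\mathsf{V}$ ($f_1\wedge f_2$ is the vector $w$ with $f(w)=\det(f_1\wedge f_2\wedge f)$ for all $f\in\mathsf{V}^*$). Structurable algebra (Allison's notion, characteristic $\ne2,3$): a unital, not necessarily associative algebra $\mathcal{A}$ with an involution (linear anti-automorphism of period at most $2$) $x\mapsto\bar x$ such that, with $V_{x,y}z=(x\bar y)z+(z\bar y)x-(z\bar x)y$, one has $[V_{x,y},V_{z,w}]=V_{V_{x,y}z,\,w}-V_{z,\,V_{y,x}w}$ for all $x,y,z,w\in\mathcal{A}$. *)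

(* Defs.v *)
From HB Require Import structures.
From mathcomp Require Import all_boot all_order all_algebra.
Set Implicit Arguments.
Unset Strict Implicit.
Unset Printing Implicit Defensive.
Import GRing.Theory.
Local Open Scope ring_scope.

HB.mixin Record Lmodule_isLieAlgebra (F : fieldType) L of GRing.Lmodule F L := {
  lie : {bilinear L -> L -> L};
  liexx : forall x : L, lie x x = 0;
  lie_jacobi : forall x y z : L,
    lie x (lie y z) + lie y (lie z x) + lie z (lie x y) = 0
}.

#[short(type="lieAlgType")]
HB.structure Definition LieAlgebra (F : fieldType) :=
  { L of Lmodule_isLieAlgebra F L & GRing.Lmodule F L }.

(* Tensor product of a finite-dimensional X with an arbitrary Y: a tensor is
   given by its coordinates in Y on the basis [vbasis {:X}] of X.
   See [tens_universal]. *)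
Definition tens (F : fieldType) (X : vectType F) (Y : lmodType F) : Type :=
  {ffun 'I_(\dim {:X}) -> Y}.

Definition tmul (F : fieldType) (X : vectType F) (Y : lmodType F)
  (x : X) (y : Y) : tens X Y := [ffun i => coord (vbasis {:X}) i x *: y].

Notation "x ⊗ y" := (tmul x y) (at level 35, no associativity) : ring_scope.

Section TensTheory.
Variables (F : fieldType) (X : vectType F) (Y : lmodType F).

Lemma tmul_linearl (y : Y) : linear (fun x : X => x ⊗ y).
Proof. by move=> k u v; apply/ffunP=> i; rewrite !ffunE linearP scalerDl scalerA. Qed.

Lemma tmul_linearr (x : X) : linear (fun y : Y => x ⊗ y).
Proof.
by move=> k u v; apply/ffunP=> i; rewrite !ffunE scalerDr !scalerA mulrC.
Qed.

Lemma tensE (t : tens X Y) : t = \sum_(i < \dim {:X}) (vbasis {:X})`_i ⊗ (t i).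
Proof.
apply/ffunP=> j; rewrite sum_ffunE (bigD1 j) //= big1 => [|i ij].
  by rewrite ffunE coord_free ?(basis_free (vbasisP _)) // eqxx scale1r addr0.
rewrite ffunE coord_free ?(basis_free (vbasisP _)) //.
by rewrite (negPf ij) scale0r.
Qed.

Lemma tens_universal (Z : lmodType F) (f : {bilinear X -> Y -> Z}) :
  exists g : {linear tens X Y -> Z}, (forall x y, g (x ⊗ y) = f x y) /\
    forall g' : {linear tens X Y -> Z}, (forall x y, g' (x ⊗ y) = f x y) ->
    g' =1 g.
Proof.
pose g (t : tens X Y) : Z := \sum_(i < \dim {:X}) f (vbasis {:X})`_i (t i).
have glin : linear g.
  move=> k u v; rewrite /g scaler_sumr -big_split; apply: eq_bigr => i _ /=.
  by rewrite !ffunE linearPr.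
pose gm := GRing.isSemilinear.Build F (tens X Y) Z _ g (GRing.semilinear_linear glin).
pose G : {linear tens X Y -> Z} := HB.pack g gm.
have Gf x y : G (x ⊗ y) = f x y.
  rewrite [in RHS](coord_vbasis (memvf x)) linear_sumlz /=.
  by apply: eq_bigr => i _; rewrite !ffunE linearZr_LR linearZl_LR.
exists G; split=> // g' g'f t.
by rewrite [t]tensE !linear_sum; apply: eq_bigr => i _; rewrite g'f Gf.
Qed.

End TensTheory.

Section SpecialLinear.
Variables (F : fieldType) (V : vectType F).
Local Notation dualV := 'Hom(V, F^o).

Definition ltr (f : 'End(V)) : F := \tr (passmx.mxof (vbasis {:V}) (vbasis {:V}) f).

Lemma ltr_is_scalar : scalar ltr.
Proof. by move=> k f g; rewrite /ltr passmx.mxof_linear linearP. Qed.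
HB.instance Definition _ := GRing.isSemilinear.Build F 'End(V) F _ ltr
  (GRing.semilinear_linear ltr_is_scalar).

Definition slv : {vspace 'End(V)} := lker (linfun (ltr : 'End(V) -> F^o)).

Lemma mem_slv f : (f \in slv) = (ltr f == 0).
Proof. by rewrite memv_ker lfunE. Qed.

Definition rank1 (u : V) (f : dualV) : 'End(V) :=
  linfun (fun w => (f w : F) *: u).

(* The projection [vsproj slv] below is applied to endomorphisms of trace zero
   when [\dim {:V} = 3] and 3 is invertible: see [slbrE], [slcircE], [slrank1E]. *)
Definition slbr (x y : subvs_of slv) : subvs_of slv :=
  vsproj slv ((vsval x \o vsval y) - (vsval y \o vsval x))%VF.

Definition slcirc (x y : subvs_of slv) : subvs_of slv :=
  vsproj slv (((vsval x \o vsval y) + (vsval y \o vsval x))%VF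
              - (2 / 3 * ltr (vsval x \o vsval y)%VF) *: \1%VF).

Definition slform (x y : subvs_of slv) : F := 3^-1 * ltr (vsval x \o vsval y)%VF.

Definition slrank1 (u : V) (f : dualV) : subvs_of slv :=
  vsproj slv (rank1 u f - (3^-1 * (f u : F)) *: \1%VF).

Lemma rank1E u f w : rank1 u f w = (f w : F) *: u.
Proof.
have lin : linear (fun w => (f w : F) *: u).
  by move=> k v w'; rewrite linearP scalerDl scalerA.
pose m := GRing.isSemilinear.Build F V V _ _ (GRing.semilinear_linear lin).
pose G : {linear V -> V} := HB.pack (fun w => (f w : F) *: u) m.
exact: (lfunE G).
Qed.

Lemma ltrE f :
  ltr f = \sum_(i < \dim {:V}) coord (vbasis {:V}) i (f (vbasis {:V})`_i).
Proof.
apply: eq_bigr => i _; rewrite !mxE /=; congr (coord _ _ (f _)).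
exact: passmx.vecof_delta.
Qed.

Lemma ltr_id : ltr \1%VF = (\dim {:V})%:R.
Proof.
rewrite ltrE (eq_bigr (fun=> 1)) => [|i _].
  by rewrite sumr_const card_ord.
by rewrite lfunE coord_free ?(basis_free (vbasisP _)) ?eqxx.
Qed.

Lemma ltr_rank1 u f : ltr (rank1 u f) = f u.
Proof.
rewrite ltrE [in RHS](coord_vbasis (memvf u)) linear_sum.
by apply: eq_bigr => i _; rewrite rank1E !linearZ /= mulrC.
Qed.

Lemma ltr_comp (f g : 'End(V)) : ltr (f \o g)%VF = ltr (g \o f)%VF.
Proof.
have E (h k : 'End(V)) : ltr (h \o k)%VF = \sum_(i < \dim {:V})
    \sum_(j < \dim {:V}) coord (vbasis {:V}) j (k (vbasis {:V})`_i) *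
      coord (vbasis {:V}) i (h (vbasis {:V})`_j).
  rewrite ltrE; apply: eq_bigr => i _; rewrite comp_lfunE.
  rewrite [X in h X](coord_vbasis (memvf _)) !linear_sum.
  by apply: eq_bigr => j _; rewrite !linearZ.
rewrite !E exchange_big; apply: eq_bigr => i _; apply: eq_bigr => j _.
exact: mulrC.
Qed.

Lemma slbrE x y :
  vsval (slbr x y) = ((vsval x \o vsval y) - (vsval y \o vsval x))%VF.
Proof. by rewrite vsprojK // mem_slv linearB /= ltr_comp subrr. Qed.

Section Dim3.
Hypotheses (V3 : \dim {:V} = 3%N) (F3 : 3%N \notin [pchar F]).

Let nz3 : 3 != 0 :> F.
Proof. by apply: contra F3 => /eqP e; rewrite inE /= e. Qed.

Lemma slcircE x y :
  vsval (slcirc x y) = ((vsval x \o vsval y) + (vsval y \o vsval x))%VF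
    - (2 / 3 * ltr (vsval x \o vsval y)%VF) *: \1%VF.
Proof.
rewrite vsprojK // mem_slv linearB linearD /= linearZ /= ltr_id V3.
rewrite [ltr (vsval y \o _)%VF]ltr_comp -mulr2n.
by rewrite mulrAC divfK // mulr_natl subrr.
Qed.

Lemma slrank1E u f :
  vsval (slrank1 u f) = rank1 u f - (3^-1 * (f u : F)) *: \1%VF.
Proof.
rewrite vsprojK // mem_slv linearB linearZ /= ltr_id V3 ltr_rank1.
by rewrite mulrAC mulVf // mul1r subrr.
Qed.

End Dim3.

(* Linear maps from the exterior cube of U, as alternating trilinear maps. *)
Record alt_trilinear (U : vectType F) (d : U -> U -> U -> F) : Prop := {
  alt_linear1 : forall v w, scalar (fun u => d u v w);
  alt_linear2 : forall u w, scalar (fun v => d u v w);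
  alt_linear3 : forall u v, scalar (d u v);
  alt12 : forall u w, d u u w = 0;
  alt13 : forall u v, d u v u = 0;
  alt23 : forall u v, d u v v = 0
}.

Definition volume_form (det : V -> V -> V -> F) : Prop :=
  alt_trilinear det /\ exists u v w, det u v w != 0.

Definition dual_volume_form (det : V -> V -> V -> F)
  (det' : dualV -> dualV -> dualV -> F) : Prop :=
  alt_trilinear det' /\
  forall (f : 'I_3 -> dualV) (v : 'I_3 -> V),
    det' (f 0) (f 1) (f 2) * det (v 0) (v 1) (v 2)
    = \det (\matrix_(i < 3, j < 3) (f i (v j) : F)).

Definition wedge (det : V -> V -> V -> F) (u1 u2 : V) : dualV :=
  linfun (det u1 u2 : V -> F^o).

(* Characterized by [dual_wedgeE]; the basis used is irrelevant. *)
Definition dual_wedge (det' : dualV -> dualV -> dualV -> F) (f1 f2 : dualV) : V :=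
  \sum_(i < \dim {:V})
    det' f1 f2 (linfun (coord (vbasis {:V}) i : V -> F^o)) *: (vbasis {:V})`_i.

Lemma wedgeE det u1 u2 w : alt_trilinear det -> wedge det u1 u2 w = det u1 u2 w.
Proof.
move=> altd; pose m := GRing.isSemilinear.Build F V F^o _ (det u1 u2)
  (GRing.semilinear_linear (alt_linear3 altd u1 u2)).
pose G : {linear V -> F^o} := HB.pack (det u1 u2) m.
exact: (lfunE G).
Qed.

Lemma dual_wedgeE det' f1 f2 (f : dualV) : alt_trilinear det' ->
  f (dual_wedge det' f1 f2) = det' f1 f2 f.
Proof.
move=> altd; pose m := GRing.isSemilinear.Build F dualV F _ (det' f1 f2)
  (GRing.semilinear_linear (alt_linear3 altd f1 f2)).
pose G : {scalar dualV} := HB.pack (det' f1 f2) m.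
have -> : f = \sum_(i < \dim {:V}) (f (vbasis {:V})`_i : F) *:
    linfun (coord (vbasis {:V}) i : V -> F^o).
  apply/lfunP => v; rewrite sum_lfunE [in LHS](coord_vbasis (memvf v)) linear_sum.
  by apply: eq_bigr => i _; rewrite scale_lfunE lfunE linearZ /= [LHS]mulrC.
rewrite -[RHS]/(G _) [RHS]linear_sum sum_lfunE; apply: eq_bigr => i _.
rewrite linearZ scale_lfunE /=; congr (_ * _).
rewrite lfunE /= /dual_wedge linear_sum (bigD1 i) //= big1 => [|j ji].
  by rewrite linearZ /= coord_free ?(basis_free (vbasisP _)) ?eqxx ?mulr1 ?addr0.
rewrite linearZ /= coord_free ?(basis_free (vbasisP _)) //.
by rewrite (negPf ji) mulr0.
Qed.

End SpecialLinear.

Notation sl V := (subvs_of (slv V)).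

Section Decomposition.
Variables (F : fieldType) (V : vectType F) (L : lieAlgType F).
Variables (A B C : lmodType F) (s : lieAlgType F).
Local Notation dualV := 'Hom(V, F^o).
Local Notation sum_space :=
  (tens (sl V) A * tens V B * tens dualV C * s)%type.

Definition inA (h : sum_space -> L) (x : sl V) (a : A) : L := h (x ⊗ a, 0, 0, 0).
Definition inB (h : sum_space -> L) (u : V) (b : B) : L := h (0, u ⊗ b, 0, 0).
Definition inC (h : sum_space -> L) (f : dualV) (c : C) : L := h (0, 0, f ⊗ c, 0).
Definition inS (h : sum_space -> L) (d : s) : L := h (0, 0, 0, d).

(* [s] is an abstract Lie algebra, identified with a subalgebra of L by [inS]. *)
Record sl_decomposition := SlDecomposition {
  sl_incl : {linear sl V -> L};
  sl_incl_inj : injective sl_incl;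
  sl_incl_lie : forall x y, sl_incl (slbr x y) = lie (sl_incl x) (sl_incl y);
  sl_decomp : {linear sum_space -> L};
  sl_decomp_bij : bijective sl_decomp;
  sl_actA : forall x y a,
    lie (sl_incl x) (inA sl_decomp y a) = inA sl_decomp (slbr x y) a;
  sl_actB : forall x u b,
    lie (sl_incl x) (inB sl_decomp u b) = inB sl_decomp (vsval x u) b;
  sl_actC : forall x f c,
    lie (sl_incl x) (inC sl_decomp f c) = - inC sl_decomp (f \o vsval x)%VF c;
  sl_centralizer : forall z : L,
    (exists d, z = inS sl_decomp d) <-> (forall x, lie (sl_incl x) z = 0);
  inS_lie : forall d d',
    inS sl_decomp (lie d d') = lie (inS sl_decomp d) (inS sl_decomp d');
  unitA : A;
  sl_inclE : forall x, sl_incl x = inA sl_decomp x unitA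
}.

Definition is_representation (M : lmodType F) (rho : s -> M -> M) : Prop :=
  forall d d' m, rho (lie d d') m = rho d (rho d' m) - rho d' (rho d m).

Record coordinate_products := CoordinateProducts {
  circA : {bilinear A -> A -> A};
  circA_comm : forall a a', circA a a' = circA a' a;
  brA : {bilinear A -> A -> A};
  brA_anti : forall a a', brA a a' = - brA a' a;
  derA : {bilinear A -> A -> s};
  derA_skew : forall a a', derA a a' = - derA a' a;
  mulAB : {bilinear A -> B -> B};
  mulCA : {bilinear C -> A -> C};
  prodT : {bilinear B -> C -> A};
  derBC : {bilinear B -> C -> s};
  crossB : {bilinear B -> B -> C};
  crossB_sym : forall b b', crossB b b' = crossB b' b;
  crossC : {bilinear C -> C -> B};
  crossC_sym : forall c c', crossC c c' = crossC c' c;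
  actA : {bilinear s -> A -> A};
  actA_repr : is_representation actA;
  actB : {bilinear s -> B -> B};
  actB_repr : is_representation actB;
  actC : {bilinear s -> C -> C};
  actC_repr : is_representation actC
}.

Record bracket_form (det : V -> V -> V -> F)
    (det' : dualV -> dualV -> dualV -> F)
    (dec : sl_decomposition) (P : coordinate_products) : Prop := {
  bracketAA : forall x y a a',
    lie (inA (sl_decomp dec) x a) (inA (sl_decomp dec) y a')
    = inA (sl_decomp dec) (slbr x y) (2^-1 *: circA P a a')
      + inA (sl_decomp dec) (slcirc x y) (2^-1 *: brA P a a')
      + inS (sl_decomp dec) (slform x y *: derA P a a');
  bracketAB : forall x a u b,
    lie (inA (sl_decomp dec) x a) (inB (sl_decomp dec) u b)
    = inB (sl_decomp dec) (vsval x u) (mulAB P a b);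
  bracketCA : forall f c x a,
    lie (inC (sl_decomp dec) f c) (inA (sl_decomp dec) x a)
    = inC (sl_decomp dec) (f \o vsval x)%VF (mulCA P c a);
  bracketBC : forall u b f c,
    lie (inB (sl_decomp dec) u b) (inC (sl_decomp dec) f c)
    = inA (sl_decomp dec) (slrank1 u f) (prodT P b c)
      + inS (sl_decomp dec) ((3^-1 * (f u : F)) *: derBC P b c);
  bracketBB : forall u1 u2 b1 b2,
    lie (inB (sl_decomp dec) u1 b1) (inB (sl_decomp dec) u2 b2)
    = inC (sl_decomp dec) (wedge det u1 u2) (crossB P b1 b2);
  bracketCC : forall f1 f2 c1 c2,
    lie (inC (sl_decomp dec) f1 c1) (inC (sl_decomp dec) f2 c2)
    = inB (sl_decomp dec) (dual_wedge det' f1 f2) (crossC P c1 c2);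
  bracketSA : forall d x a,
    lie (inS (sl_decomp dec) d) (inA (sl_decomp dec) x a)
    = inA (sl_decomp dec) x (actA P d a);
  bracketSB : forall d u b,
    lie (inS (sl_decomp dec) d) (inB (sl_decomp dec) u b)
    = inB (sl_decomp dec) u (actB P d b);
  bracketSC : forall d f c,
    lie (inS (sl_decomp dec) d) (inC (sl_decomp dec) f c)
    = inC (sl_decomp dec) f (actC P d c)
}.

Definition mulA (P : coordinate_products) (a a' : A) : A :=
  2^-1 *: circA P a a' + 2^-1 *: brA P a a'.

(* ((a1, c), (b, a2)) is the 2x2 matrix with rows (a1 c) and (b a2). *)
Definition coord_alg : lmodType F := (A * C * (B * A))%type.

Definition coord_mul (P : coordinate_products) (X Y : coord_alg) : coord_alg :=
  let: ((a1, c), (b, a2)) := X in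
  let: ((a1', c'), (b', a2')) := Y in
  ((mulA P a1 a1' - prodT P b' c, mulCA P c' a1 + mulCA P c a2' + crossB P b b'),
   (mulAB P a1' b + mulAB P a2 b' + crossC P c c', mulA P a2' a2 - prodT P b c')).

Definition coord_bar (X : coord_alg) : coord_alg :=
  let: ((a1, c), (b, a2)) := X in ((a2, c), (b, a1)).

End Decomposition.

Section Structurable.
Variables (F : fieldType) (M : lmodType F) (mul : M -> M -> M) (bar : M -> M).

Definition Vop (x y z : M) : M :=
  mul (mul x (bar y)) z + mul (mul z (bar y)) x - mul (mul z (bar x)) y.

Record structurable : Prop := {
  structurable_linearl : forall y, linear (mul^~ y);
  structurable_linearr : forall x, linear (mul x);
  structurable_unit : exists e, left_id e mul /\ right_id e mul;
  structurable_bar_linear : linear bar;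
  structurable_bar_anti : forall x y, bar (mul x y) = mul (bar y) (bar x);
  structurable_bar_invol : involutive bar;
  structurable_Vop : forall x y z w t,
    Vop x y (Vop z w t) - Vop z w (Vop x y t)
    = Vop (Vop x y z) w t - Vop z (Vop y x w) t
}.

End Structurable.

(* Main.v *)
Require Import Defs.
From HB Require Import structures.
From mathcomp Require Import all_boot all_order all_algebra.
Set Implicit Arguments.
Unset Strict Implicit.
Unset Printing Implicit Defensive.
Import GRing.Theory.
Local Open Scope ring_scope.

(** Write E_ij for the rank one map of sl(V) attached to the i-th vector of a
    basis e of V and the j-th vector of the dual basis f, and X for the matrix
    with rows (a1 c) and (b a2).  The algebra of such matrices is visible inside
    L: up to signs, u12 X = E_12⊗a1 + E_21⊗a2 + e_3⊗b + f_3⊗c, and u23, u13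
    are obtained by permuting indices.  These are the three nontrivial graded
    pieces of L for the group of diagonal matrices with entries 1 and -1 in
    SL(V), and, with the signs chosen in [u12], [u23], [u13], the bracket of two
    of them is the product of matrices:
      [u12 X, u23 Y] = u13 (X Y),
      [u12 X, u13 Y] = u23 (bar X  Y),
      [u13 X, u23 Y] = u12 (X  bar Y)       ([u_unitary_triple]).
    These brackets only involve root vectors of sl(V) that are not opposite
    ([lie_matrix_image]), so that no derivation D_{a,a'} or D_{b,c} appears in
    them and no identity between the products of A, B, C is needed beforehand.

    The three relations force the structurable identity, by the Jacobi identity
    alone.  Put p x = u13 x + u23 x and m x = u13 x - u23 x: they are eigenvectors
    of ad (u12 1), for the eigenvalues 1 and -1.  The Jacobi identity gives
      [[p x, m y], p z] = - 2 p (V_{x,y} z),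
      [[p x, m y], m z] =   2 m (V_{y,x} z)
    ([lie_pm_Vop] and the symmetry [unitary_triple_opp]); hence
    p V_{x,y} is, up to a scalar, the action of [p x, m y], and the identity
    for [V_{x,y}, V_{z,w}] is the derivation property of ad [p x, m y] on the
    bracket [p z, m w], applied to p t ([unitary_triple_Vop]).  Here 2 is
    invertible and p is injective ([u13D23_inj]).

    The unit of the matrix algebra comes from the element 1 of A: the action of
    sl(V)⊗1 on the four summands of L says that 1 acts as the identity on A, B
    and C. *)

(** * Lie brackets *)

Section LieFacts.
Variables (F : fieldType) (L : lieAlgType F).
Implicit Types x y z : L.

Lemma lieC x y : lie x y = - lie y x.
Proof.
apply/eqP; rewrite -addr_eq0; have := liexx (x + y).
by rewrite linearDl /= !linearDr /= !liexx add0r addr0 => ->.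
Qed.

Lemma lie_der x y z : lie x (lie y z) = lie (lie x y) z + lie y (lie x z).
Proof.
have := lie_jacobi x y z; rewrite [lie z x]lieC [lie z (lie _ _)]lieC linearNr /=.
by move/eqP; rewrite subr_eq add0r subr_eq => /eqP.
Qed.

Lemma lie_lie x y z : lie (lie x y) z = lie x (lie y z) - lie y (lie x z).
Proof. by rewrite lie_der addrK. Qed.

End LieFacts.

(** * Lie algebras coordinatized by an algebra with involution *)

Section UnitaryTriple.
Variables (F : fieldType) (L : lieAlgType F) (M : lmodType F).
Variables (mul : M -> M -> M) (bar : M -> M) (e : M).
Hypotheses (mul_linearl : forall y, linear (mul^~ y)).
Hypotheses (mul_el : left_id e mul) (mul_er : right_id e mul).
Hypotheses (bar_linear : linear bar).
Hypotheses (bar_anti : forall x y, bar (mul x y) = mul (bar y) (bar x)).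
Hypotheses (bar_invol : involutive bar).

(** With u21 x = u12 (bar x), u32 x = u23 (bar x) and u31 x = - u13 (bar x), these
    are the relations [u_ij x, u_jk y] = u_ik (x y) of a Steinberg unitary Lie
    algebra for the hermitian form diag (1, -1, 1).  An isotropic form is chosen
    so that ad (u12 e) has eigenvectors over F on the sum of the images of u13
    and u23; the form diag (1, 1, 1) would require a square root of -1. *)
Record unitary_triple (u12 u23 u13 : {linear M -> L}) : Prop := {
  lie12_23 : forall x y, lie (u12 x) (u23 y) = u13 (mul x y);
  lie12_13 : forall x y, lie (u12 x) (u13 y) = u23 (mul (bar x) y);
  lie13_23 : forall x y, lie (u13 x) (u23 y) = u12 (mul x (bar y))
}.

Let mulBl x y z : mul (x - y) z = mul x z - mul y z.
Proof. by rewrite addrC -scaleN1r mul_linearl scaleN1r addrC. Qed.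

Let mulDl x y z : mul (x + y) z = mul x z + mul y z.
Proof. by rewrite -[x]scale1r mul_linearl !scale1r. Qed.

Let barB x y : bar (x - y) = bar x - bar y.
Proof. by rewrite addrC -scaleN1r bar_linear scaleN1r addrC. Qed.

Let barD x y : bar (x + y) = bar x + bar y.
Proof. by rewrite -[x]scale1r bar_linear !scale1r. Qed.

Let bar_e : bar e = e.
Proof.
by rewrite -[LHS]mul_el -{1}[e]bar_invol -bar_anti mul_el bar_invol.
Qed.

Section Triple.
Variables (u12 u23 u13 : {linear M -> L}).
Hypothesis uT : unitary_triple u12 u23 u13.

Lemma lie13_13_12 x y z : lie (lie (u13 x) (u13 y)) (u12 z)
  = u12 (mul y (mul (bar x) z) - mul x (mul (bar y) z)).
Proof.
rewrite lie_lie ![lie _ (u12 z)]lieC !(lie12_13 uT) !linearNr /=.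
by rewrite !(lie13_23 uT) !bar_anti !bar_invol opprK addrC linearB.
Qed.

Lemma lie13_13_23 x y z : lie (lie (u13 x) (u13 y)) (u23 z)
  = u23 (mul (mul z (bar x)) y - mul (mul z (bar y)) x).
Proof.
rewrite lie_lie !(lie13_23 uT) ![lie (u13 _) _]lieC !(lie12_13 uT).
by rewrite !bar_anti !bar_invol opprK addrC linearB.
Qed.

Lemma lie23_23_13 x y z : lie (lie (u23 x) (u23 y)) (u13 z)
  = u13 (mul (mul z (bar y)) x - mul (mul z (bar x)) y).
Proof.
rewrite lie_lie ![lie _ (u13 z)]lieC !(lie13_23 uT) !linearNr /=.
by rewrite ![lie (u23 _) _]lieC !(lie12_23 uT) !opprK linearB.
Qed.

Lemma lie23_23_12e x y : lie (lie (u23 x) (u23 y)) (u12 e)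
  = u12 (mul y (bar x) - mul x (bar y)).
Proof.
rewrite lie_lie ![lie _ (u12 e)]lieC !(lie12_23 uT) !mul_el !linearNr /=.
by rewrite ![lie (u23 _) _]lieC !(lie13_23 uT) !opprK linearB.
Qed.

(** The action of [u13 x, u13 y] on u13 is deduced from its actions on u12 and
    u23, since u13 z = [u12 e, u23 z]. *)
Lemma lie13_13_13 x y z : lie (lie (u13 x) (u13 y)) (u13 z)
  = u13 (mul (mul y (bar x) - mul x (bar y)) z
         + (mul (mul z (bar x)) y - mul (mul z (bar y)) x)).
Proof.
have -> : u13 z = lie (u12 e) (u23 z) by rewrite (lie12_23 uT) mul_el.
rewrite lie_der lie13_13_12 !mul_er lie13_13_23 !(lie12_23 uT) mul_el.
by rewrite -linearD.
Qed.

Lemma lie23_23_23 x y z : lie (lie (u23 x) (u23 y)) (u23 z)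
  = u23 (mul (mul x (bar y) - mul y (bar x)) z
         + (mul (mul z (bar y)) x - mul (mul z (bar x)) y)).
Proof.
have -> : u23 z = lie (u12 e) (u13 z) by rewrite (lie12_13 uT) bar_e mul_el.
rewrite lie_der lie23_23_12e lie23_23_13 !(lie12_13 uT) bar_e mul_el.
by rewrite -linearD barB !bar_anti !bar_invol.
Qed.

Lemma lie_pmE x y : lie (u13 x + u23 x) (u13 y - u23 y)
  = lie (u13 x) (u13 y) - lie (u23 x) (u23 y)
    - u12 (mul x (bar y) + mul y (bar x)).
Proof.
rewrite linearDl /= !linearBr /= [lie (u23 x) (u13 y)]lieC !(lie13_23 uT).
by rewrite linearD /= opprD [- u12 _ - _ in LHS]addrC addrACA.
Qed.

(** Both components add up to the same combination: the contributions of
    (y bar(x)) z cancel, and those of the three terms of V_{x,y} z are doubled. *)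
Lemma lie_pm_Vop x y z :
  lie (lie (u13 x + u23 x) (u13 y - u23 y)) (u13 z + u23 z)
  = - (u13 (Vop mul bar x y z *+ 2) + u23 (Vop mul bar x y z *+ 2)).
Proof.
have cancel (p q t : M) : q - p + t + t - (p + q) = - ((p - t) *+ 2).
  rewrite opprD [LHS](AC (4*2) ((3*2)*(4*5)*(1*6))) /= subrr addr0 -mulr2n.
  by rewrite -mulNrn opprB.
rewrite lie_pmE !linearBl /= !linearDr /= lie13_13_13 lie13_13_23.
rewrite lie23_23_13 lie23_23_23 (lie12_23 uT) (lie12_13 uT).
rewrite barD !bar_anti !bar_invol !mulBl !mulDl /Vop.
(* [V_{x,y} z] is [p + r - mul (mul z (bar x)) y = p - t]. *)
set p := mul (mul x _) _; set q := mul (mul y _) _; set r := mul (mul z _) x.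
set t := mul (mul z _) y - r.
have -> : r - mul (mul z (bar x)) y = - t by rewrite opprB.
have -> : p + r - mul (mul z (bar x)) y = p - t by rewrite opprB addrA.
rewrite !opprD -!linearN /= [LHS](AC ((2*2)*2) ((1*3*6)*(2*4*5))) /=.
rewrite -!linearD -(cancel p q t); congr (u13 _ + u23 _); first by rewrite opprK.
rewrite -[X in t - X]/(p - q - t) !opprB !opprD.
by rewrite [LHS](AC (1*(1*2)*2) ((3*4*1*2)*(6*5))).
Qed.
End Triple.

(** This symmetry exchanges u13 + u23 and u13 - u23. *)
Lemma unitary_triple_opp (u12 u23 u13 : {linear M -> L}) :
  unitary_triple u12 u23 u13 -> unitary_triple (-%R \o u12) (-%R \o u23) u13.
Proof.
move=> [R1 R2 R3]; split=> x y /=.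
- by rewrite linearNl linearNr /= opprK.
- by rewrite linearNl /= R2.
- by rewrite linearNr /= R3.
Qed.

Hypothesis F2 : 2%N \notin [pchar F].

(** Up to the factors -2 and 2, V_{x,y} acts on p z as [p x, m y] does, and V_{y,x}
    on m w: the bracket of [p x, m y] and [p z, m w] can then be computed on p t in
    two ways. *)
Lemma unitary_triple_Vop (u12 u23 u13 : {linear M -> L}) :
  unitary_triple u12 u23 u13 -> (forall x, u13 x + u23 x = 0 -> x = 0) ->
  forall x y z w t,
    Vop mul bar x y (Vop mul bar z w t) - Vop mul bar z w (Vop mul bar x y t)
    = Vop mul bar (Vop mul bar x y z) w t - Vop mul bar z (Vop mul bar y x w) t.
Proof.
move=> uT inj x y z w t.
pose p x := u13 x + u23 x; pose m x := u13 x - u23 x; pose W := Vop mul bar.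
have pB a b : p (a - b) = p a - p b.
  by rewrite /p !linearB /= addrACA -opprD.
have pMn a n : p (a *+ n) = p a *+ n by rewrite /p mulrnDl !linearMn.
have mMn a n : m (a *+ n) = m a *+ n by rewrite /m mulrnBl !linearMn.
have Vp a b c : lie (lie (p a) (m b)) (p c) = - (p (W a b c) *+ 2).
  by rewrite (lie_pm_Vop uT) -pMn.
have Vm a b c : lie (lie (p a) (m b)) (m c) = m (W b a c) *+ 2.
  have := lie_pm_Vop (unitary_triple_opp uT) b a c; rewrite /= opprK.
  rewrite -/(p a) -/(m b) -/(m c) [lie (m b) _]lieC linearNl -mMn.
  by move=> /oppr_inj.
have cancel4 a b : p a *+ 2 *+ 2 = p b *+ 2 *+ 2 -> a = b.
  move=> /eqP; rewrite -subr_eq0 -!mulrnBl -!mulrnA -pB -pMn => /eqP/inj/eqP.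
  rewrite -scaler_nat scaler_eq0 subr_eq0.
  have two : 2%:R != 0 :> F by apply: contra F2 => /eqP q; rewrite inE /= q.
  by rewrite (natrM F 2 2) mulf_eq0 (negPf two) => /eqP.
apply: cancel4; rewrite -/W (pB (W x y _)) (pB (W (W x y z) w t)) !mulrnBl.
have := lie_der (lie (p x) (m y)) (lie (p z) (m w)) (p t).
rewrite [lie _ (lie (p z) (m w))]lie_der !Vp Vm; clearbody p m W.
rewrite linearDl /= linearNl linearMnl linearMnr linearNr !linearNl /=.
rewrite !linearNr /= !linearMnl !linearMnr /= !Vp.
by rewrite !mulNrn !opprK => ->; rewrite addrK.
Qed.
End UnitaryTriple.

(** * Volume forms and dual bases *)

Section DualBases.
Variables (F : fieldType) (V : vectType F).
Local Notation dualV := 'Hom(V, F^o).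

Lemma functionals_separate (u v : V) : (forall f : dualV, f u = f v) -> u = v.
Proof.
move=> E; rewrite [u](coord_vbasis (memvf u)) [v](coord_vbasis (memvf v)).
apply: eq_bigr => i _; congr (_ *: _).
by have := E (linfun (coord (vbasis {:V}) i : V -> F^o)); rewrite !lfunE.
Qed.

Section Alternating.
Variables (U : vectType F) (d : U -> U -> U -> F).
Hypothesis altd : alt_trilinear d.

Lemma alt_swap12 u v w : d v u w = - d u v w.
Proof.
have D x y z : d (x + y) z w = d x z w + d y z w.
  by have := alt_linear1 altd z w 1 x y; rewrite scale1r mul1r.
have D' x y z : d x (y + z) w = d x y w + d x z w.
  by have := alt_linear2 altd x w 1 y z; rewrite scale1r mul1r.
apply/eqP; rewrite -addr_eq0; have := alt12 altd (u + v) w.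
by rewrite D !D' !(alt12 altd) add0r addr0 addrC => ->.
Qed.

Lemma alt_swap23 u v w : d u w v = - d u v w.
Proof.
have D x y z : d u (x + y) z = d u x z + d u y z.
  by have := alt_linear2 altd u z 1 x y; rewrite scale1r mul1r.
have D' x y z : d u x (y + z) = d u x y + d u x z.
  by have := alt_linear3 altd u x 1 y z; rewrite scale1r mul1r.
apply/eqP; rewrite -addr_eq0; have := alt23 altd u (v + w).
by rewrite D !D' !(alt23 altd) add0r addr0 addrC => ->.
Qed.

End Alternating.

Variables (det : V -> V -> V -> F).

Lemma wedge_swap u v : alt_trilinear det -> wedge det v u = - wedge det u v.
Proof.
move=> alt; apply/lfunP => w.
by rewrite opp_lfunE /= !wedgeE // (alt_swap12 alt).
Qed.

(** A volume form is nonzero on some triple; after rescaling its first vector,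
    the dual family consists of the wedges of the vectors two by two. *)
Lemma volume_basis : volume_form det ->
  exists (e : 'I_3 -> V) (f : 'I_3 -> dualV),
    [/\ forall i j, f i (e j) = (i == j)%:R :> F, det (e 0) (e 1) (e 2) = 1
      & [/\ f 0 = wedge det (e 1) (e 2), f 1 = wedge det (e 2) (e 0)
          & f 2 = wedge det (e 0) (e 1)]].
Proof.
move=> [alt [u [v [w duvw]]]].
have dZ k : det (k *: u) v w = k * det u v w.
  have := alt_linear1 alt v w k u 0.
  have := alt_linear1 alt v w (-1) 0 0; rewrite scaler0 addr0 mulN1r addNr => ->.
  by rewrite !addr0.
pose e := tnth [tuple (det u v w)^-1 *: u; v; w].
exists e, (tnth [tuple wedge det (e 1) (e 2); wedge det (e 2) (e 0);
                      wedge det (e 0) (e 1)]).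
have e1 : det (e 0) (e 1) (e 2) = 1 by rewrite dZ mulVf.
have e2 : det (e 1) (e 2) (e 0) = 1.
  by rewrite (alt_swap23 alt) (alt_swap12 alt) opprK.
have e3 : det (e 2) (e 0) (e 1) = 1.
  by rewrite (alt_swap12 alt) (alt_swap23 alt) opprK.
split=> // -[[|[|[|//]]] i3] [[|[|[|//]]] j3]; rewrite (wedgeE _ _ _ alt);
  first [exact: e1 | exact: e2 | exact: e3 | exact: alt13 | exact: alt23].
Qed.

(** For every functional g, the matrix of the values of f k, f i, g at e k, e i, e j
    is lower triangular with diagonal 1, 1, g (e j). *)
Lemma dual_wedge_basis det' (e : 'I_3 -> V) (f : 'I_3 -> dualV)
    (i j k : 'I_3) (eps : F) :
  dual_volume_form det det' -> (forall i j, f i (e j) = (i == j)%:R :> F) ->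
  i != j -> j != k -> i != k ->
  eps * det (e k) (e i) (e j) = 1 -> dual_wedge det' (f k) (f i) = eps *: e j.
Proof.
move=> [alt' det'E] fe ij jk ik ekij; apply: functionals_separate => g.
rewrite (dual_wedgeE _ _ _ alt') linearZ /=.
pose f' (m : 'I_3) := if m == 0 then f k else if m == 1 then f i else g.
pose e' (m : 'I_3) := if m == 0 then e k else if m == 1 then e i else e j.
have := det'E f' e'; rewrite det_trig; last first.
  apply/is_trig_mxP => m n; rewrite mxE.
  case: m n => [[|[|[|//]]] m3] [[|[|[|//]]] n3] //= _; rewrite fe.
  - by rewrite eq_sym (negPf ik).
  - by rewrite eq_sym (negPf jk).
  - by rewrite (negPf ij).
rewrite !big_ord_recl big_ord0 !mxE /f' /e' /= !fe !eqxx !mul1r mulr1 => E.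
by rewrite -[LHS]mulr1 -ekij mulrCA E.
Qed.
End DualBases.

(** * Tensors and the components of L *)

Section TensorFacts.
Variables (F : fieldType) (X : vectType F) (Y : lmodType F).

Lemma tmulZl k (x : X) (y : Y) : (k *: x) ⊗ y = k *: (x ⊗ y).
Proof. by apply/ffunP => i; rewrite !ffunE linearZ scalerA. Qed.

(** Contractions recover the coefficients of a sum of pure tensors whose left
    factors are linearly independent. *)
Lemma tens_contract (lam : X -> F) : scalar lam ->
  exists g : {linear tens X Y -> Y}, forall x y, g (x ⊗ y) = lam x *: y.
Proof.
move=> lamlin.
pose lamm := GRing.isSemilinear.Build F X F _ lam (GRing.semilinear_linear lamlin).
pose l : {scalar X} := HB.pack lam lamm.
pose g (t : tens X Y) : Y := \sum_(i < \dim {:X}) l (vbasis {:X})`_i *: t i.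
have glin : linear g.
  move=> k t t'; rewrite /g scaler_sumr -big_split; apply: eq_bigr => i _ /=.
  by rewrite !ffunE scalerDr !scalerA mulrC.
pose gm := GRing.isSemilinear.Build F (tens X Y) Y _ g (GRing.semilinear_linear glin).
pose G : {linear tens X Y -> Y} := HB.pack g gm.
exists G => x y; rewrite -[lam]/(l : X -> F).
rewrite [in RHS](coord_vbasis (memvf x)) linear_sum scaler_suml.
by apply: eq_bigr => i _; rewrite ffunE scalerA [in RHS]linearZ /= mulrC.
Qed.

End TensorFacts.

Section Components.
Variables (F : fieldType) (V : vectType F) (L : lieAlgType F).
Variables (A B C : lmodType F) (s : lieAlgType F).
Local Notation dualV := 'Hom(V, F^o).
Local Notation sum_space :=
  (tens (sl V) A * tens V B * tens dualV C * s)%type.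
Variable h : {linear sum_space -> L}.

Lemma inA_is_linear x : linear (inA h x).
Proof.
move=> k a a'; rewrite /inA tmul_linearr -linearP; congr (h (_, _, _, _));
  by rewrite /= scaler0 addr0.
Qed.
HB.instance Definition _ x := GRing.isSemilinear.Build F A L _ (inA h x)
  (GRing.semilinear_linear (inA_is_linear x)).

Lemma inB_is_linear u : linear (inB h u).
Proof.
move=> k a a'; rewrite /inB tmul_linearr -linearP; congr (h (_, _, _, _));
  by rewrite /= scaler0 addr0.
Qed.
HB.instance Definition _ u := GRing.isSemilinear.Build F B L _ (inB h u)
  (GRing.semilinear_linear (inB_is_linear u)).

Lemma inC_is_linear f : linear (inC h f).
Proof.
move=> k a a'; rewrite /inC tmul_linearr -linearP; congr (h (_, _, _, _));
  by rewrite /= scaler0 addr0.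
Qed.
HB.instance Definition _ f := GRing.isSemilinear.Build F C L _ (inC h f)
  (GRing.semilinear_linear (inC_is_linear f)).

Lemma inAZl k x a : inA h (k *: x) a = k *: inA h x a.
Proof.
by rewrite /inA tmulZl -linearZ; congr (h (_, _, _, _)); rewrite /= scaler0.
Qed.

Lemma inBZl k u b : inB h (k *: u) b = k *: inB h u b.
Proof.
by rewrite /inB tmulZl -linearZ; congr (h (_, _, _, _)); rewrite /= scaler0.
Qed.

Lemma inCZl k f c : inC h (k *: f) c = k *: inC h f c.
Proof.
by rewrite /inC tmulZl -linearZ; congr (h (_, _, _, _)); rewrite /= scaler0.
Qed.

Lemma inS0 : inS h 0 = 0.
Proof. exact: (linear0 h). Qed.

End Components.

(** * The algebra of matrices and its involution *)

Section CoordinateAlgebra.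
Variables (F : fieldType) (A B C : lmodType F) (s : lieAlgType F).
Variable P : coordinate_products A B C s.
Local Notation M := (coord_alg A B C).

Lemma mulA_is_bilinear : bilinear_for
  (GRing.Scale.Law.clone _ _ *:%R _) (GRing.Scale.Law.clone _ _ *:%R _)
  (Defs.mulA P).
Proof.
split=> a k x y; rewrite /Defs.mulA ?linearPl ?linearPr /= !scalerDr.
  by rewrite !scalerA ![_ * k]mulrC addrACA.
by rewrite !scalerA ![_ * k]mulrC addrACA.
Qed.
HB.instance Definition _ := bilinear_isBilinear.Build F A A A _ _ (Defs.mulA P)
  mulA_is_bilinear.

Lemma coord_mul_linearl (Y : M) : linear (coord_mul P ^~ Y).
Proof.
case: Y => [[a1' c'] [b' a2']] k [[a1 c] [b a2]] [[x1 z] [y x2]] /=.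
rewrite !linearPl !linearPr /=.
congr ((_, _), (_, _)); rewrite /= !scalerDr ?scalerN ?opprD.
- exact: addrACA.
- by rewrite [LHS](AC (2*2*2) ((1*3*5)*(2*4*6))).
- by rewrite [LHS](AC (2*2*2) ((1*3*5)*(2*4*6))).
- exact: addrACA.
Qed.

Lemma coord_mul_linearr (X : M) : linear (coord_mul P X).
Proof.
case: X => [[a1 c] [b a2]] k [[a1' c'] [b' a2']] [[x1 z] [y x2]] /=.
rewrite !linearPl !linearPr /=.
congr ((_, _), (_, _)); rewrite /= !scalerDr ?scalerN ?opprD.
- exact: addrACA.
- by rewrite [LHS](AC (2*2*2) ((1*3*5)*(2*4*6))).
- by rewrite [LHS](AC (2*2*2) ((1*3*5)*(2*4*6))).
- exact: addrACA.
Qed.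

Lemma coord_bar_linear : linear (@coord_bar F A B C).
Proof. by move=> k [[a1 c] [b a2]] [[x1 z] [y x2]]. Qed.

Lemma coord_bar_anti (X Y : M) :
  coord_bar (coord_mul P X Y) = coord_mul P (coord_bar Y) (coord_bar X).
Proof.
case: X Y => [[a1 c] [b a2]] [[a1' c'] [b' a2']] /=.
rewrite (crossB_sym P b') (crossC_sym P c').
by rewrite [mulCA P c a2' + _]addrC [mulAB P a2 b' + _]addrC.
Qed.

Lemma coord_bar_invol : involutive (@coord_bar F A B C).
Proof. by case=> [[a1 c] [b a2]]. Qed.

End CoordinateAlgebra.

(** * Brackets of root vectors *)

Section RootBrackets.
Variables (F : fieldType) (V : vectType F).
Variables (det : V -> V -> V -> F).
Local Notation dualV := 'Hom(V, F^o).
Variables (det' : dualV -> dualV -> dualV -> F).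
Variables (L : lieAlgType F) (A B C : lmodType F) (s : lieAlgType F).
Variables (dec : sl_decomposition V L A B C s).
Variables (P : coordinate_products A B C s).
Hypothesis brP : bracket_form det det' dec P.
Implicit Types (u v : V) (f g : dualV) (a : A) (b : B) (c : C).

Local Notation inA := (inA (sl_decomp dec)).
Local Notation inB := (inB (sl_decomp dec)).
Local Notation inC := (inC (sl_decomp dec)).
Local Notation inS := (inS (sl_decomp dec)).

Lemma vsval_slrank1 u f : f u = 0 -> vsval (slrank1 u f) = rank1 u f.
Proof.
move=> fu; rewrite /slrank1 fu mulr0 scale0r subr0 vsprojK //.
by rewrite mem_slv ltr_rank1 fu.
Qed.

Lemma rank1_comp u f v g :
  (rank1 u f \o rank1 v g)%VF = (f v : F) *: rank1 u g.
Proof.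
apply/lfunP => w; rewrite comp_lfunE scale_lfunE !rank1E linearZ /= scalerA.
by rewrite mulrC.
Qed.

(** The condition g u = 0 excludes the brackets of opposite root vectors: the
    product of the two rank one maps in one order vanishes, so that their
    commutator and their symmetrized product coincide and the form (x|y) is 0.
    The two halves of the product of A then recombine. *)
Lemma lieAA u f v g a a' : f u = 0 -> g v = 0 -> g u = 0 ->
  lie (inA (slrank1 u f) a) (inA (slrank1 v g) a')
  = (f v : F) *: inA (slrank1 u g) (Defs.mulA P a a').
Proof.
move=> fu gv gu; have gf : (rank1 v g \o rank1 u f)%VF = 0.
  by rewrite rank1_comp gu scale0r.
have tr0 : ltr (rank1 u f \o rank1 v g)%VF = 0.
  by rewrite ltr_comp gf linear0.
have br : slbr (slrank1 u f) (slrank1 v g) = (f v : F) *: slrank1 u g.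
  apply: (val_inj : injective vsval).
  by rewrite slbrE linearZ /= !vsval_slrank1 // gf subr0 rank1_comp.
have ci : slcirc (slrank1 u f) (slrank1 v g) = (f v : F) *: slrank1 u g.
  rewrite -br /slcirc /slbr !vsval_slrank1 // tr0 gf.
  by rewrite addr0 subr0 mulr0 scale0r subr0.
rewrite (bracketAA brP) br ci /slform !vsval_slrank1 // tr0 mulr0 scale0r inS0.
by rewrite addr0 !inAZl -scalerDr -linearD.
Qed.

Lemma lieAB u f v a b : f u = 0 ->
  lie (inA (slrank1 u f) a) (inB v b) = (f v : F) *: inB u (mulAB P a b).
Proof.
by move=> fu; rewrite (bracketAB brP) vsval_slrank1 // rank1E inBZl.
Qed.

Lemma lieCA f v g c a : g v = 0 ->
  lie (inC f c) (inA (slrank1 v g) a) = (f v : F) *: inC g (mulCA P c a).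
Proof.
move=> gv; rewrite (bracketCA brP) vsval_slrank1 // -inCZl; congr (inC _ _).
by apply/lfunP => w; rewrite comp_lfunE scale_lfunE rank1E linearZ /= [LHS]mulrC.
Qed.

Lemma lieBC u f b c : f u = 0 ->
  lie (inB u b) (inC f c) = inA (slrank1 u f) (prodT P b c).
Proof. by move=> fu; rewrite (bracketBC brP) fu mulr0 scale0r inS0 addr0. Qed.

Lemma lieBA u f v a b : f u = 0 ->
  lie (inB v b) (inA (slrank1 u f) a) = - ((f v : F) *: inB u (mulAB P a b)).
Proof. by move=> fu; rewrite lieC lieAB. Qed.

Lemma lieAC f v g c a : g v = 0 ->
  lie (inA (slrank1 v g) a) (inC f c) = - ((f v : F) *: inC g (mulCA P c a)).
Proof. by move=> gv; rewrite lieC lieCA. Qed.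

Lemma lieCB u f b c : f u = 0 ->
  lie (inC f c) (inB u b) = - inA (slrank1 u f) (prodT P b c).
Proof. by move=> fu; rewrite lieC lieBC. Qed.

Section Frame.
Variables (e : 'I_3 -> V) (f : 'I_3 -> dualV).
Hypothesis fe : forall i j, f i (e j) = (i == j)%:R :> F.

Definition matrix_image (i j k : 'I_3) a1 a2 b c : L :=
  inA (slrank1 (e i) (f j)) a1 + inA (slrank1 (e j) (f i)) a2
  + inB (e k) b + inC (f k) c.

(** The bracket of the pieces of indices {i, j} and {j, k} lies in the piece of
    index {i, k}; eps is the sign of the permutation i, j, k of the indices.  All
    the brackets of [unitary_triple] are instances. *)
Lemma lie_matrix_image (i j k : 'I_3) (eps : F) a1 a2 b c a1' a2' b' c' :
  i != j -> j != k -> k != i ->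
  wedge det (e k) (e i) = eps *: f j ->
  dual_wedge det' (f k) (f i) = eps *: e j ->
  lie (matrix_image i j k a1 a2 b c) (matrix_image j k i a1' a2' b' c')
  = matrix_image i k j (Defs.mulA P a1 a1' - prodT P b' c)
     (prodT P b c' - Defs.mulA P a2' a2)
     (mulAB P a2 b' - mulAB P a1' b + eps *: crossC P c c')
     (mulCA P c a2' - mulCA P c' a1 + eps *: crossB P b b').
Proof.
move=> ij jk ki wB wC.
have fne m n : m != n -> f m (e n) = 0 :> F by move=> /negPf mn; rewrite fe mn.
have [ji kj ik] : [/\ j != i, k != j & i != k] by split; rewrite eq_sym.
have [fij fjk fki] :
    [/\ f i (e j) = 0 :> F, f j (e k) = 0 :> F & f k (e i) = 0 :> F].
  by split; apply: fne.
have [fji fkj fik] :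
    [/\ f j (e i) = 0 :> F, f k (e j) = 0 :> F & f i (e k) = 0 :> F].
  by split; apply: fne.
have fee m : f m (e m) = 1 :> F by rewrite fe eqxx.
rewrite /matrix_image !linearDl /= !linearDr /=.
(* [E_ji, E_kj] is the only bracket to be reversed before [lieAA] applies: the
   composite E_ji E_kj vanishes but E_kj E_ji does not. *)
rewrite [lie (inA (slrank1 (e j) (f i)) _) (inA (slrank1 (e k) _) _)]lieC.
rewrite !lieAA // !lieAB // !lieBA // !lieAC // !lieCA // lieBC // lieCB //.
rewrite (bracketBB brP) wB (bracketCC brP) wC inCZl inBZl.
rewrite !(fee, fij, fjk, fki, fji, fkj, fik).
rewrite !(scale1r, scale0r, oppr0, addr0, add0r).
move: (Defs.mulA P a1 a1') (Defs.mulA P a2' a2) => m1 m2.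
rewrite !linearD /= !linearN !linearZ /=.
by rewrite [LHS](AC (2*2*3*3) ((1*9)*(7*3)*(4*5*10)*(8*2*6))).
Qed.

Lemma matrix_image_swap i j k a1 a2 b c :
  matrix_image i j k a1 a2 b c = matrix_image j i k a2 a1 b c.
Proof. by rewrite /matrix_image [inA _ a1 + _]addrC. Qed.

Lemma contract_sl i j : exists g : {linear tens (sl V) A -> A},
  forall k l a, k != l ->
    g (slrank1 (e k) (f l) ⊗ a) = ((i == k) && (l == j))%:R *: a.
Proof.
have [|g gE] := @tens_contract F (sl V) A (fun x => f i (vsval x (e j))).
  by move=> k x y; rewrite linearP /= add_lfunE scale_lfunE linearP.
exists g => k l a kl; rewrite gE vsval_slrank1; last by rewrite fe eq_sym (negPf kl).
by rewrite rank1E linearZ /= !fe andbC -mulnb natrM.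
Qed.

Lemma contract_vec i : exists g : {linear tens V B -> B},
  forall k b, g (e k ⊗ b) = (i == k)%:R *: b.
Proof.
have [|g gE] := @tens_contract F V B (f i); first by move=> k x y; rewrite linearP.
by exists g => k b; rewrite gE fe.
Qed.

Lemma contract_dual i : exists g : {linear tens dualV C -> C},
  forall k c, g (f k ⊗ c) = (k == i)%:R *: c.
Proof.
have [|g gE] := @tens_contract F dualV C (fun g => g (e i)).
  by move=> k x y; rewrite add_lfunE scale_lfunE.
by exists g => k c; rewrite gE fe.
Qed.

Lemma inA_slrank1_inj i j : i != j -> injective (inA (slrank1 (e i) (f j))).
Proof.
move=> ij a a' /(bij_inj (sl_decomp_bij dec)) [].
have [g gE] := contract_sl i j.
by move/(congr1 g); rewrite !gE // !eqxx !scale1r.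
Qed.

Lemma inB_inj i : injective (inB (e i)).
Proof.
move=> a a' /(bij_inj (sl_decomp_bij dec)) [].
have [g gE] := contract_vec i.
by move/(congr1 g); rewrite !gE // !eqxx !scale1r.
Qed.

Lemma inC_inj i : injective (inC (f i)).
Proof.
move=> a a' /(bij_inj (sl_decomp_bij dec)) [].
have [g gE] := contract_dual i.
by move/(congr1 g); rewrite !gE // !eqxx !scale1r.
Qed.

Local Notation one := (unitA dec).

Lemma slbr_slrank1 i j k : i != j -> j != k -> k != i ->
  slbr (slrank1 (e i) (f j)) (slrank1 (e j) (f k)) = slrank1 (e i) (f k).
Proof.
move=> ij jk ki; apply: (val_inj : injective vsval); rewrite slbrE.
rewrite !vsval_slrank1 ?fe ?(negPf ki) ?[j == i]eq_sym ?[k == j]eq_sym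
  ?(negPf ij) ?(negPf jk) //.
by rewrite !rank1_comp !fe eqxx (negPf ki) scale1r scale0r subr0.
Qed.

(** The bracket of E_12⊗1 with E_23⊗a is known twice: as the action of the given
    copy of sl(V), and from the product of A. *)
Lemma mulA_1l a : Defs.mulA P one a = a.
Proof.
apply: (@inA_slrank1_inj 0 2) => //.
have := sl_actA dec (slrank1 (e 0) (f 1)) (slrank1 (e 1) (f 2)) a.
by rewrite slbr_slrank1 // sl_inclE lieAA ?fe // scale1r.
Qed.

Lemma mulA_1r a : Defs.mulA P a one = a.
Proof.
apply: (@inA_slrank1_inj 0 2) => //.
have := sl_actA dec (slrank1 (e 1) (f 2)) (slrank1 (e 0) (f 1)) a.
rewrite sl_inclE [LHS]lieC lieAA ?fe // scale1r.
move/eqP; rewrite eqr_oppLR => /eqP ->.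
have -> : slbr (slrank1 (e 1) (f 2)) (slrank1 (e 0) (f 1))
    = - slrank1 (e 0) (f 2).
  by rewrite -(@slbr_slrank1 0 1 2) // /slbr -linearN opprB.
by rewrite -[- slrank1 _ _]scaleN1r inAZl scaleN1r opprK.
Qed.

Lemma mulAB_1l b : mulAB P one b = b.
Proof.
apply: (@inB_inj 0); have := sl_actB dec (slrank1 (e 0) (f 1)) (e 1) b.
by rewrite sl_inclE lieAB ?fe // vsval_slrank1 ?fe // rank1E fe !scale1r.
Qed.

Lemma mulCA_1r c : mulCA P c one = c.
Proof.
apply: (@inC_inj 1); have := sl_actC dec (slrank1 (e 0) (f 1)) (f 0) c.
rewrite sl_inclE lieAC ?fe // => /oppr_inj; rewrite scale1r => ->.
rewrite vsval_slrank1 ?fe //; congr (inC _ _); apply/lfunP => w.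
by rewrite comp_lfunE rank1E linearZ /= fe [LHS]mulr1.
Qed.

Local Notation M := (coord_alg A B C).

Lemma coord_unit_l : left_id (((one, 0), (0, one)) : M) (coord_mul P).
Proof.
case=> [[a1 c] [b a2]] /=.
rewrite !(linear0l, linear0r) mulA_1l mulA_1r mulAB_1l mulCA_1r.
by rewrite !(addr0, subr0, add0r).
Qed.

Lemma coord_unit_r : right_id (((one, 0), (0, one)) : M) (coord_mul P).
Proof.
case=> [[a1 c] [b a2]] /=.
rewrite !(linear0l, linear0r) mulA_1l mulA_1r mulAB_1l mulCA_1r.
by rewrite !(addr0, subr0, add0r).
Qed.

(** * The three copies of the matrix algebra inside L *)

Hypothesis det1 : det (e 0) (e 1) (e 2) = 1.
Hypotheses (f0E : f 0 = wedge det (e 1) (e 2)).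
Hypotheses (f1E : f 1 = wedge det (e 2) (e 0)).
Hypotheses (f2E : f 2 = wedge det (e 0) (e 1)).
Hypothesis alt_det : alt_trilinear det.
Hypothesis det'_dual : dual_volume_form det det'.

(** The signs are chosen to obtain the three relations of [unitary_triple]; the
    sign of E_31 reflects the hermitian form diag (1, -1, 1), in which the indices
    1 and 3 have equal signs. *)
Definition u12 (X : M) : L := matrix_image 0 1 2 X.1.1 X.2.2 X.2.1 (- X.1.2).
Definition u23 (X : M) : L := matrix_image 1 2 0 X.1.1 X.2.2 (- X.2.1) X.1.2.
Definition u13 (X : M) : L :=
  matrix_image 0 2 1 X.1.1 (- X.2.2) (- X.2.1) (- X.1.2).

Lemma matrix_image_linear i j k t a1 a2 b c a1' a2' b' c' :
  matrix_image i j k (t *: a1 + a1') (t *: a2 + a2') (t *: b + b') (t *: c + c')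
  = t *: matrix_image i j k a1 a2 b c + matrix_image i j k a1' a2' b' c'.
Proof.
rewrite /matrix_image !linearP /= !scalerDr.
by rewrite [LHS](AC (2*2*2*2) ((1*3*5*7)*(2*4*6*8))).
Qed.

Lemma u12_is_linear : linear u12.
Proof.
by move=> t X Y; rewrite -matrix_image_linear /u12 /= opprD scalerN.
Qed.
HB.instance Definition _ := GRing.isSemilinear.Build F M L _ u12
  (GRing.semilinear_linear u12_is_linear).

Lemma u23_is_linear : linear u23.
Proof.
by move=> t X Y; rewrite -matrix_image_linear /u23 /= opprD scalerN.
Qed.
HB.instance Definition _ := GRing.isSemilinear.Build F M L _ u23
  (GRing.semilinear_linear u23_is_linear).

Lemma u13_is_linear : linear u13.
Proof.
by move=> t X Y; rewrite -matrix_image_linear /u13 /= !opprD !scalerN.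
Qed.
HB.instance Definition _ := GRing.isSemilinear.Build F M L _ u13
  (GRing.semilinear_linear u13_is_linear).

Lemma u_unitary_triple :
  unitary_triple (coord_mul P) (@coord_bar F A B C) u12 u23 u13.
Proof.
have d102 : det (e 1) (e 0) (e 2) = -1 by rewrite (alt_swap12 alt_det) det1.
have d120 : det (e 1) (e 2) (e 0) = 1.
  by rewrite (alt_swap23 alt_det) d102 opprK.
have d210 : det (e 2) (e 1) (e 0) = -1 by rewrite (alt_swap12 alt_det) d120.
have d201 : det (e 2) (e 0) (e 1) = 1.
  by rewrite (alt_swap23 alt_det) d210 opprK.
have dw := dual_wedge_basis det'_dual fe.
have w20 : wedge det (e 2) (e 0) = 1 *: f 1 by rewrite scale1r f1E.
have w21 : wedge det (e 2) (e 1) = -1 *: f 0.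
  by rewrite scaleN1r f0E (wedge_swap _ _ alt_det).
have w10 : wedge det (e 1) (e 0) = -1 *: f 2.
  by rewrite scaleN1r f2E (wedge_swap _ _ alt_det).
have dw20 : dual_wedge det' (f 2) (f 0) = 1 *: e 1.
  by apply: dw; rewrite // d201 mulr1.
have dw21 : dual_wedge det' (f 2) (f 1) = -1 *: e 0.
  by apply: dw; rewrite // d210 mulrNN mulr1.
have dw10 : dual_wedge det' (f 1) (f 0) = -1 *: e 2.
  by apply: dw; rewrite // d102 mulrNN mulr1.
split=> -[[a1 c] [b a2]] [[a1' c'] [b' a2']]; rewrite /= /u12 /u23 /u13 /=.
- rewrite (lie_matrix_image _ _ _ _ _ _ _ _ _ _ _ w20 dw20) //.
  rewrite !scale1r !(linearNl, linearNr) /= !opprK !opprB !opprD.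
  by rewrite [- mulAB P a2 b' - _]addrC [- mulCA P c a2' - _]addrC.
(* The odd permutations (2 1 3) and (1 3 2) of indices require exchanging the
   roles of the two diagonal entries, which is where the involution appears. *)
- rewrite [matrix_image 0 1 2 _ _ _ _]matrix_image_swap.
  rewrite (lie_matrix_image _ _ _ _ _ _ _ _ _ _ _ w21 dw21) //.
  rewrite !scaleN1r !(linearNl, linearNr) /= !opprK !opprD.
  rewrite [- prodT P b c' + _]addrC [- mulAB P a1 b' - _]addrC.
  by rewrite [mulCA P c a2' + _]addrC.
- rewrite [matrix_image 1 2 0 _ _ _ _]matrix_image_swap.
  rewrite (lie_matrix_image _ _ _ _ _ _ _ _ _ _ _ w10 dw10) //.
  rewrite !scaleN1r !(linearNl, linearNr) /= !opprK !opprD.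
  rewrite [- prodT P b c' + _]addrC [mulAB P a2 b' + _]addrC.
  by rewrite [- mulCA P c a1' - _]addrC.
Qed.

(** In u13 X + u23 X the entries of X occur on linearly independent vectors:
    E_13 + E_23, E_32 - E_31, e_1 + e_2 and f_1 - f_2. *)
Lemma u13D23_inj X : u13 X + u23 X = 0 -> X = 0.
Proof.
case: X => [[a1 c] [b a2]] /= E.
pose E_ i j := slrank1 (e i) (f j).
pose tA : tens (sl V) A :=
  E_ 0 2 ⊗ a1 + E_ 2 0 ⊗ (- a2) + (E_ 1 2 ⊗ a1 + E_ 2 1 ⊗ a2).
pose tB : tens V B := e 1 ⊗ (- b) + e 0 ⊗ (- b).
pose tC : tens dualV C := f 1 ⊗ (- c) + f 0 ⊗ c.
have : sl_decomp dec (tA, tB, tC, 0) = sl_decomp dec 0.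
  rewrite linear0 -E /u13 /u23 /matrix_image /inA /inB /inC -!linearD.
  by congr (sl_decomp dec (_, _, _, _)); rewrite /= ?addr0 ?add0r.
move/(bij_inj (sl_decomp_bij dec)) => -[EA EB EC].
have [g1 g1E] := contract_sl 0 2; have [g2 g2E] := contract_sl 2 0.
have [g3 g3E] := contract_vec 0; have [g4 g4E] := contract_dual 0.
move: EA (EA) EB EC => /(congr1 g1) + /(congr1 g2) + /(congr1 g3) + /(congr1 g4).
rewrite !linearD /= !linear0 !g1E // !g2E // !g3E !g4E /=.
rewrite !(scale0r, scale1r, add0r, addr0) => -> /eqP + /eqP + ->.
by rewrite !oppr_eq0 => /eqP -> /eqP ->.
Qed.

End Frame.
End RootBrackets.

(** * The structurable algebra *)

Theorem theorem3p1 (F : fieldType)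
    (F2 : 2%N \notin [pchar F]) (F3 : 3%N \notin [pchar F])
    (V : vectType F) (V3 : \dim {:V} = 3%N)
    (det : V -> V -> V -> F) (det_vol : volume_form det)
    (det' : 'Hom(V, F^o) -> 'Hom(V, F^o) -> 'Hom(V, F^o) -> F)
    (det'_dual : dual_volume_form det det')
    (L : lieAlgType F) (A B C : lmodType F) (s : lieAlgType F)
    (dec : sl_decomposition V L A B C s)
    (P : coordinate_products A B C s)
    (brP : bracket_form det det' dec P) :
  structurable (coord_mul P) (@coord_bar F A B C).
Proof.
have [e [f [fe det1 [f0E f1E f2E]]]] := volume_basis det_vol.
have alt_det := proj1 det_vol.
have uT := u_unitary_triple brP fe det1 f0E f1E f2E alt_det det'_dual.
have el := coord_unit_l brP fe; have er := coord_unit_r brP fe.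
split.
- exact: coord_mul_linearl.
- exact: coord_mul_linearr.
- by exists ((unitA dec, 0), (0, unitA dec)).
- exact: coord_bar_linear.
- exact: coord_bar_anti.
- exact: coord_bar_invol.
exact: (unitary_triple_Vop (coord_mul_linearl P) el er (@coord_bar_linear F A B C)
  (coord_bar_anti P) (@coord_bar_invol F A B C) F2 uT (u13D23_inj fe)).
Qed.
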